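(* Let $\Gamma$ be a finite Abelian group with $|\Gamma|\ge 3$ and let $g\in\Gamma\setminus\{0\}$. Let $G$ be a graph in which every non-pendant vertex is a weak support vertex. Then $G$ is $\Gamma$-vertex magic with magic constant $g$ if and only if $\deg(x)\not\equiv 2\pmod{o(g)}$ for every $x\in\Omega_{\mathfrak{w}}(G)$.
   Context: Graphs are finite, simple and undirected; $o(g)$ is the order of $g$. For an additive Abelian group $\Gamma$ with identity $0$ and a graph $G$, a $\Gamma$-vertex magic labeling is a map $\ell:V(G)\to\Gamma\setminus\{0\}$ for which there is $\mu\in\Gamma$ (the magic constant) with $w(v)=\sum_{u\in N(v)}\ell(u)=\mu$ for every vertex $v$. A pendant vertex has degree $1$; a weak support vertex is a vertex adjacent to exactly one pendant vertex; $\Omega_{\mathfrak{w}}(G)$ is the set of weak support vertices. *)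

(* Defs.v *)
From mathcomp Require Import all_boot all_order all_algebra all_fingroup.
Set Implicit Arguments.
Unset Strict Implicit.
Unset Printing Implicit Defensive.
Import GRing.Theory.
Local Open Scope ring_scope.

(* A finite simple graph is a symmetric irreflexive relation on a finType. *)
Section Graph.
Variables (V : finType) (adj : rel V).

Definition neighbors (v : V) : {set V} := [set u | adj v u].
Definition degree (v : V) : nat := #|neighbors v|.
Definition pendant (v : V) : bool := degree v == 1%N.
(* A weak support vertex may itself be pendant, as in a K_2 component. *)
Definition weak_support : {set V} :=
  [set v | #|[set u in neighbors v | pendant u]| == 1%N].

End Graph.

Section VertexMagic.
Variables (Gamma : zmodType) (V : finType) (adj : rel V).

Definition weight (l : V -> Gamma) (v : V) : Gamma :=
  \sum_(u in neighbors adj v) l u.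

Definition vertex_magic_labeling (l : V -> Gamma) (mu : Gamma) : Prop :=
  (forall v, l v != 0) /\ (forall v, weight l v = mu).

Definition vertex_magic_with_constant (mu : Gamma) : Prop :=
  exists l : V -> Gamma, vertex_magic_labeling l mu.

End VertexMagic.

(* Main.v *)
(** A pendant vertex forces its neighbour to be labelled [g]; every non-pendant
    vertex has a pendant neighbour, hence carries [g].  At a weak support vertex
    [x] the weight condition then determines the label of its unique pendant
    neighbour as [2g - deg(x) g], which is nonzero exactly when
    [deg(x)] is not congruent to 2 modulo [o(g)].  Conversely these forced
    values define a labeling. *)
Require Import Defs.
From mathcomp Require Import all_boot all_order all_algebra all_fingroup.
From mathcomp Require Import cyclic.
Set Implicit Arguments.
Unset Strict Implicit.
Unset Printing Implicit Defensive.
Import GRing.Theory.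
Local Open Scope ring_scope.

(** Powers in the group structure of [Gamma] are multiples, so the usual criterion for equal powers
    applies. *)
Lemma mulrn_eq_mod_order (Gamma : finZmodType) (g : Gamma) (m n : nat) :
  (g *+ m == g *+ n) = (m == n %[mod #[g]%g]).
Proof. by rewrite -eq_expg_mod_order !FinRing.zmodXgE. Qed.

Section Pendants.
Variables (V : finType) (adj : rel V).

Lemma pendantP (v : V) :
  reflect (exists u, neighbors adj v = [set u]) (pendant adj v).
Proof. exact: cards1P. Qed.

Lemma weak_supportP (x : V) :
  reflect (exists2 p, p \in neighbors adj x & pendant adj p /\
             {in neighbors adj x, forall u, u != p -> ~~ pendant adj u})
          (x \in weak_support adj).
Proof.
rewrite inE; apply: (iffP cards1P) => [[p /setP E]|[p px [pp uniq]]].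
  have := E p; rewrite !inE eqxx => /andP[xp pp].
  exists p; rewrite ?inE //; split=> // u xu; have := E u.
  by move: xu; rewrite !inE => -> /= -> .
exists p; apply/setP => u; rewrite !inE; apply/andP/eqP => [[xu pu]|->].
  apply: contraTeq pu; apply: uniq; first by rewrite inE.
by move: px; rewrite inE.
Qed.

Lemma weight_single (Gamma : zmodType) (l : V -> Gamma) (v u : V) :
  neighbors adj v = [set u] -> weight adj l v = l u.
Proof. by rewrite /weight => ->; rewrite big_set1. Qed.

Lemma weight_all_but_one (Gamma : zmodType) (l : V -> Gamma) (g : Gamma)
    (x p : V) :
  p \in neighbors adj x ->
  {in neighbors adj x, forall u, u != p -> l u = g} ->
  weight adj l x = l p + g *+ degree adj x - g.
Proof.
move=> px lg; rewrite /weight (bigD1 p px) /= -addrA; congr (_ + _).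
rewrite (eq_bigr (fun=> g)) => [|u /andP[]]; last exact: lg.
(* The degree counts [p] too; its term is the [g] subtracted. *)
rewrite /degree -sumr_const (bigD1 p px) /=.
by rewrite addrAC subrr add0r.
Qed.

Hypothesis adj_sym : symmetric adj.

Lemma neighbors_sym (u v : V) :
  (u \in neighbors adj v) = (v \in neighbors adj u).
Proof. by rewrite !inE adj_sym. Qed.

Lemma pendant_neighbors (p x : V) :
  pendant adj p -> p \in neighbors adj x -> neighbors adj p = [set x].
Proof.
by move=> /pendantP[u Eu]; rewrite neighbors_sym Eu => /set1P->.
Qed.

Lemma weak_support_label (Gamma : zmodType) (l : V -> Gamma) (g : Gamma)
    (x : V) :
  (forall v, weight adj l v = g) -> x \in weak_support adj -> l x = g.
Proof.
move=> lw /weak_supportP[p px [pp _]].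
by rewrite -(lw p) (weight_single _ (pendant_neighbors pp px)).
Qed.

(* The neighborhood of a pendant vertex is a singleton, so the sum is
   [2g - deg(x) g] for its unique neighbor [x]. *)
Definition forced_label (Gamma : zmodType) (g : Gamma) (v : V) : Gamma :=
  if pendant adj v
  then \sum_(x in neighbors adj v) (g *+ 2 - g *+ degree adj x)
  else g.

Lemma forced_label_pendant (Gamma : zmodType) (g : Gamma) (p x : V) :
  pendant adj p -> p \in neighbors adj x ->
  forced_label g p = g *+ 2 - g *+ degree adj x.
Proof.
move=> pp px.
by rewrite /forced_label pp (pendant_neighbors pp px) big_set1.
Qed.

(** Handles [K_2] components, whose two ends are pendant and weak support at once. *)
Lemma pendant_edge_weak_support (v u : V) :
  neighbors adj v = [set u] -> pendant adj u -> v \in weak_support adj.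
Proof.
move=> Ev pu; apply/weak_supportP; exists u; rewrite Ev ?set11 //.
by split=> // w /set1P->; rewrite eqxx.
Qed.

Hypothesis nonpendant_weak_support :
  forall v : V, ~~ pendant adj v -> v \in weak_support adj.

Lemma weight_forced_label (Gamma : zmodType) (g : Gamma) (v : V) :
  weight adj (forced_label g) v = g.
Proof.
have [vs|vns] := boolP (v \in weak_support adj).
  have /weak_supportP[p pv [pp np]] := vs.
  rewrite (@weight_all_but_one _ _ g _ p) // => [|u uv up].
    by rewrite (forced_label_pendant _ pp pv) subrK mulr2n addrK.
  by rewrite /forced_label (negPf (np u uv up)).
(* Otherwise [v] is pendant and its only neighbour [u] is not, since a pendant [u] would make [v]
   weak support; so [u] carries [g]. *)
have /pendantP[u Ev] : pendant adj v.
  by apply: contraR vns; apply: nonpendant_weak_support.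
rewrite (weight_single _ Ev) /forced_label ifN //.
by apply: contra vns; apply: pendant_edge_weak_support.
Qed.

(** The neighbours of [x] other than [p] are non-pendant, hence weak support vertices labelled [g];
    the weight equation at [x] is then solved for [l p]. *)
Lemma label_pendant_of_weak_support (Gamma : zmodType) (l : V -> Gamma)
    (g : Gamma) (x p : V) :
  (forall v, weight adj l v = g) -> p \in neighbors adj x ->
  {in neighbors adj x, forall u, u != p -> ~~ pendant adj u} ->
  l p = g *+ 2 - g *+ degree adj x.
Proof.
move=> lw px np; have := lw x.
rewrite (@weight_all_but_one _ l g x p) // => [/eqP|u ux up].
  by rewrite subr_eq -mulr2n => /eqP <-; rewrite addrK.
by apply: (weak_support_label lw); apply/nonpendant_weak_support/np.
Qed.

End Pendants.

Theorem theorem2p5 (Gamma : finZmodType) (hGamma : (3 <= #|Gamma|)%N)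
    (g : Gamma) (hg : g != 0)
    (V : finType) (adj : rel V)
    (adj_sym : symmetric adj) (adj_irr : irreflexive adj)
    (hG : forall v : V, ~~ pendant adj v -> v \in weak_support adj) :
  vertex_magic_with_constant adj g <->
  (forall x : V, x \in weak_support adj -> degree adj x != 2 %[mod #[g]%g]).
Proof.
split=> [[l [l0 lw]] x /weak_supportP[p px [_ np]]|degP].
  (* The incongruence becomes the nonvanishing of the label of [p]. *)
  rewrite -mulrn_eq_mod_order eq_sym -subr_eq0.
  by rewrite -(label_pendant_of_weak_support adj_sym hG lw px np).
exists (forced_label adj g).
split=> [v|v]; last exact: weight_forced_label.
have [pv|npv] := boolP (pendant adj v); last by rewrite /forced_label ifN.
have /pendantP[x Ev] := pv.
have vx : v \in neighbors adj x by rewrite neighbors_sym // Ev set11.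
rewrite (forced_label_pendant adj_sym _ pv vx) subr_eq0 eq_sym.
rewrite mulrn_eq_mod_order; apply: degP.
(* The neighbour [x] of [v] is weak support even when pendant: then [x] and [v] span a [K_2]
   component. *)
have [px|] := boolP (pendant adj x); last exact: hG.
apply: (pendant_edge_weak_support _ pv).
by apply: pendant_neighbors; rewrite // Ev set11.
Qed.
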